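(* There exist connected matroids $\mathcal{M}$, $\mathcal{M}'$, $\mathcal{M}''$ of the same rank $d$ on the same ground set $[n]$ such that $\mathcal{M}'$ is an initial matroid of $\mathcal{M}$ and $\mathcal{M}''$ is an initial matroid of $\mathcal{M}'$, but $\mathcal{M}''$ is not an initial matroid of $\mathcal{M}$. (That is, the relation ''is an initial matroid of'' is not transitive, even among connected matroids.)
   Context: Let $\mathcal{M}$ be a matroid of rank $d$ on $[n]$ with set of bases $\mathcal{B}$. The Dressian $\mathrm{Dr}_{\mathcal{M}}\subset\mathbb{R}^{\mathcal{B}}$ is the set of all $v\in\mathbb{R}^{\mathcal{B}}$ such that, extending $v$ by $v_\sigma=\infty$ for $d$-subsets $\sigma\notin\mathcal{B}$, for every $S\in\binom{[n]}{d-2}$ and distinct $i,j,k,l\in[n]\setminus S$ the minimum of $v_{Sij}+v_{Skl}$, $v_{Sik}+v_{Sjl}$, $v_{Sil}+v_{Sjk}$ is attained at least twice (or is $\infty$). Here $Sij$ denotes $S\cup\{i,j\}$. For $v\in\mathrm{Dr}_{\mathcal{M}}$, the initial matroid $\mathcal{M}_v$ is the matroid on $[n]$ with bases $\mathcal{B}_v=\{\sigma\in\mathcal{B} : v_\sigma \text{ is minimal}\}$. A matroid $\mathcal{M}'$ is an initial matroid of $\mathcal{M}$ if $\mathcal{M}'=\mathcal{M}_v$ for some $v\in\mathrm{Dr}_{\mathcal{M}}$. A matroid is connected if it is not a direct sum of two matroids on nonempty ground sets. *)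

(* Defs.v *)
From mathcomp Require Import all_boot all_order all_algebra.
From mathcomp Require Import reals constructive_ereal.

Set Implicit Arguments.
Unset Strict Implicit.
Unset Printing Implicit Defensive.

Import Order.TTheory GRing.Theory Num.Theory.
Local Open Scope ring_scope.

(* Matroids of rank [d] on the ground set [E], presented by their bases. The
   ground set is a subset of a finite type so that the summands of a direct sum
   live over the same type as the sum. *)
Record matroid (T : finType) (E : {set T}) (d : nat) := Matroid {
  bases : {set {set T}};
  bases_neq0 : bases != set0;
  bases_sub : forall A, A \in bases -> A \subset E;
  bases_card : forall A, A \in bases -> #|A| = d;
  bases_exchange : forall A B, A \in bases -> B \in bases ->
    forall x, x \in A :\: B ->
    exists2 y, y \in B :\: A & y |: (A :\ x) \in bases
}.

Definition direct_sum (T : finType) (E : {set T}) (d : nat) (M : matroid E d)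
    (E1 E2 : {set T}) (d1 d2 : nat) (M1 : matroid E1 d1) (M2 : matroid E2 d2) :
    Prop :=
  [/\ E = E1 :|: E2, [disjoint E1 & E2] &
      bases M = [set A :|: B | A in bases M1, B in bases M2]].

Definition connected (T : finType) (E : {set T}) (d : nat) (M : matroid E d) :
    Prop :=
  ~ exists (E1 E2 : {set T}) (d1 d2 : nat)
      (M1 : matroid E1 d1) (M2 : matroid E2 d2),
      [/\ E1 != set0, E2 != set0 & direct_sum M M1 M2].

Section Dressian.
Variables (R : realType) (T : finType) (E : {set T}) (d : nat).
Implicit Types M : matroid E d.

Definition basis M := {A : {set T} | A \in bases M}.

Definition extend M (v : {ffun basis M -> R}) (A : {set T}) : \bar R :=
  if insub A is Some b then (v b)%:E else +oo%E.

Definition min_attained_twice (a b c : \bar R) : Prop :=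
  let m := Order.min a (Order.min b c) in
  m = +oo%E \/ (2 <= count_mem m [:: a; b; c])%N.

(* [#|S| + 2 = d], rather than [#|S| = d - 2], so that there is no such [S]
   when [d < 2]. *)
Definition dressian M (v : {ffun basis M -> R}) : Prop :=
  forall S : {set T}, S \subset E -> (#|S| + 2)%N = d ->
  forall i j k l : T, uniq [:: i; j; k; l] ->
    {subset [:: i; j; k; l] <= E :\: S} ->
    let w a b := extend v (a |: (b |: S)) in
    min_attained_twice (w i j + w k l)%E (w i k + w j l)%E (w i l + w j k)%E.

Definition initial_bases M (v : {ffun basis M -> R}) : {set {set T}} :=
  [set val b | b : basis M & [forall c, v b <= v c]].

(* [M'] is the initial matroid of [M] at some [v] in the Dressian of [M]; two
   matroids on the same ground set are identified when their bases agree. *)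
Definition initial_matroid M M' : Prop :=
  exists2 v : {ffun basis M -> R}, dressian v & bases M' = initial_bases v.

End Dressian.

(* Main.v *)
(* Let K be the cycle matroid of K4: six points a, b, c, d, e, f in a plane whose
   lines are abd, bce, acf, def. M adds to K two points z, w in general
   position; the bases of M' are the bases of M meeting {z, w}, i.e. the six
   points are put in general position on one line; M'' makes a and d parallel
   in M'. In both steps the function that is 0 on the smaller matroid and 1
   elsewhere lies in the Dressian. The six points seen from z form a
   quadrangular set, whose tropical relation
     v_zbd + v_zce + v_zaf = v_zad + v_zbe + v_zcf
   holds for every v in the Dressian of M. All six triples but zad are bases of
   M'', so v cannot be minimal exactly on the bases of M''.

   Points a, b, c, d, e, f, z, w are numbered 0, ..., 7, and a set is encoded by
   its bit vector, so that the finitely many conditions on M, M', M'' other than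
   the last one are checked by evaluation. *)
Require Import Defs.
From mathcomp Require Import all_boot all_order all_algebra.
From mathcomp Require Import reals constructive_ereal lra.

Set Implicit Arguments.
Unset Strict Implicit.
Unset Printing Implicit Defensive.

Import Order.TTheory GRing.Theory Num.Theory.

(** * Connectedness from exchanging single elements *)

(** In a direct sum every basis meets [E1] in the same number of elements, whereas replacing an
    element of [E1] by one of [E2] lowers that number by one. *)
Lemma exchangeable_connected (T : finType) (E : {set T}) d (M : matroid E d) :
  (forall x y, x \in E -> y \in E -> x != y -> exists C : {set T},
     [/\ x \notin C, y \notin C, x |: C \in bases M & y |: C \in bases M]) ->
  connected M.
Proof.
move=> exM [E1 [E2 [d1 [d2 [M1 [M2 [E1n0 E2n0 [defE dE12 defM]]]]]]]].
have [[x xE1] [y yE2]] := (set0Pn _ E1n0, set0Pn _ E2n0).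
have yE1 : y \notin E1 by rewrite (disjointFl dE12).
have xy : x != y by apply: contraNneq yE1 => <-.
have [|||C [xC yC xCM yCM]] := exM x y; rewrite ?defE ?inE ?xE1 ?yE2 ?orbT //.
have cardE1 A : A \in bases M -> #|A :&: E1| = d1.
  rewrite defM => /imset2P[A1 A2 A1M A2M ->].
  rewrite setIUl (setIidPl (bases_sub A1M)) (_ : A2 :&: E1 = set0).
    by rewrite setU0 (bases_card A1M).
  apply/eqP; rewrite setI_eq0 disjoint_sym.
  exact: disjointWr (bases_sub A2M) dE12.
have := cardE1 _ xCM; rewrite -(cardE1 _ yCM) !setIUl.
rewrite (setIidPl _) ?sub1set// cardsU1 inE (negPf xC).
have /eqP -> : [set y] :&: E1 == set0 by rewrite setI_eq0 disjoints1.
by rewrite set0U add1n => /eqP; rewrite eqn_leq ltnn.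
Qed.

(** * Matroids given by bit vectors *)

Section BitVectors.
Variable n : nat.
Implicit Types (A : {set 'I_n}) (s t : bitseq).

Definition bits A : bitseq := [seq i \in A | i <- enum 'I_n].

Lemma size_bits A : size (bits A) = n.
Proof. by rewrite size_map size_enum_ord. Qed.

Lemma nth_bits A (i : 'I_n) : nth false (bits A) i = (i \in A).
Proof. by rewrite (nth_map i) ?size_enum_ord// nth_ord_enum. Qed.

Lemma count_bits A : count id (bits A) = #|A|.
Proof. by rewrite count_map cardE enumT size_filter. Qed.

Lemma bits_set b (x : 'I_n) A (B : {set 'I_n}) :
  (forall y, (y \in B) = if y == x then b else y \in A) ->
  bits B = set_nth false (bits A) x b.
Proof.
move=> BE; apply: (@eq_from_nth _ false) => [|i].
  by rewrite size_set_nth !size_bits (maxn_idPr _).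
rewrite size_bits => lti; rewrite nth_set_nth /= -[i]/(val (Ordinal lti)).
by rewrite !nth_bits BE.
Qed.

Lemma bits_setU1 (x : 'I_n) A : bits (x |: A) = set_nth false (bits A) x true.
Proof. by apply: bits_set => y; rewrite !inE; case: eqP. Qed.

Lemma bits_setD1 (x : 'I_n) A : bits (A :\ x) = set_nth false (bits A) x false.
Proof. by apply: bits_set => y; rewrite !inE; case: eqP. Qed.

Lemma bits_set_of s : size s = n -> bits [set x : 'I_n | nth false s x] = s.
Proof.
move=> sz; apply: (@eq_from_nth _ false) => [|i]; rewrite size_bits ?sz// => lti.
by rewrite -[i]/(val (Ordinal lti)) nth_bits inE.
Qed.

Fixpoint bitseqs m : seq bitseq :=
  if m is m'.+1 then
    let L := bitseqs m' in [seq true :: s | s <- L] ++ [seq false :: s | s <- L]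
  else [:: [::]].

Lemma mem_bitseqs m s : (s \in bitseqs m) = (size s == m).
Proof.
have inj (b : bool) : injective (cons b) by move=> ? ? [].
have cross (b b' : bool) L t : b != b' -> (b' :: t \in [seq b :: s | s <- L]) = false.
  by move=> bb'; apply/mapP => -[u _ [/eqP]]; rewrite eq_sym (negPf bb').
elim: m s => [|m IH] [|[] s] //=.
- by rewrite mem_cat; apply/norP; split; apply/mapP => -[].
- by rewrite mem_cat (mem_map (inj true)) cross // orbF IH.
- by rewrite mem_cat (mem_map (inj false)) cross // IH.
Qed.

Definition is_matroid_bits d (r : pred bitseq) :=
  let B := [seq s <- bitseqs n | r s] in
  [&& B != [::], all (fun s => count id s == d) B &
    all (fun s => all (fun t =>
      all (fun x => has (fun y => r (set_nth false (set_nth false s x false) y true))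
             [seq y <- iota 0 n | nth false t y && ~~ nth false s y])
        [seq x <- iota 0 n | nth false s x && ~~ nth false t x]) B) B].

Lemma matroid_of_bits d (r : pred bitseq) : is_matroid_bits d r ->
  exists M : matroid [set: 'I_n] d, bases M = [set A | r (bits A)].
Proof.
case/and3P=> Bn0 /allP Bd /allP Bx.
have memB A : (bits A \in [seq s <- bitseqs n | r s]) = r (bits A).
  by rewrite mem_filter mem_bitseqs size_bits eqxx andbT.
have M0 : [set A | r (bits A)] != set0.
  (* The head of the nonempty list of accepted vectors codes a basis. *)
  case: [seq _ <- _ | _] (mem_filter r ^~ (bitseqs n)) Bn0 => // s B E _.
  have := E s; rewrite inE eqxx mem_bitseqs => /esym/andP[rs /eqP sz].
  apply/set0Pn; exists [set x : 'I_n | nth false s x].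
  by rewrite inE bits_set_of.
have Mc A : A \in [set A | r (bits A)] -> #|A| = d.
  by rewrite inE -memB => /Bd/eqP <-; rewrite count_bits.
have Mx A B : A \in [set A | r (bits A)] -> B \in [set A | r (bits A)] ->
    forall x, x \in A :\: B ->
    exists2 y, y \in B :\: A & y |: (A :\ x) \in [set A | r (bits A)].
  rewrite !inE -!memB => /Bx/allP AB /AB/allP {}AB x.
  rewrite !inE => /andP[xB xA].
  have /AB/hasP[y] : val x \in [seq x <- iota 0 n |
      nth false (bits A) x && ~~ nth false (bits B) x].
    by rewrite mem_filter !nth_bits xA xB mem_iota ltn_ord.
  rewrite mem_filter mem_iota => /andP[+ /andP[_ lty]].
  rewrite -[y]/(val (Ordinal lty)) !nth_bits => /andP[yB yA] rAB.
  exists (Ordinal lty); first by rewrite inE yA.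
  by rewrite inE bits_setU1 bits_setD1.
by exists (@Matroid _ _ _ _ M0 (fun A _ => subsetT A) Mc Mx).
Qed.

End BitVectors.

Local Open Scope ring_scope.

(** * The 0/1 function that selects a smaller matroid *)

Section SubValuation.
Variables (R : realType) (T : finType) (E : {set T}) (d : nat).
Variables M N : matroid E d.

Definition sub_valuation : {ffun basis M -> R} :=
  [ffun b => (val b \notin bases N)%:R].

Lemma initial_sub_valuation :
  bases N \subset bases M -> bases N = initial_bases sub_valuation.
Proof.
move=> NM; apply/setP=> A; apply/idP/imsetP => [AN|[b + ->]].
  exists (exist _ A (subsetP NM A AN)) => //; rewrite inE; apply/forallP => c.
  by rewrite !ffunE /= AN ler0n.
rewrite inE => /forallP bmin; apply: contraT => bN.
(* [N] has a basis, so the minimum is 0 and the value 1 is never minimal. *)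
have [B BN] := set0Pn _ (bases_neq0 N).
have := bmin (exist _ B (subsetP NM B BN)).
by rewrite !ffunE /= BN bN ler10.
Qed.

End SubValuation.

(** * Checking the three-term relations by evaluation *)

Section OptionEreal.
Variable R : realType.

(** A 0/1 function and its pairwise sums only take natural values or infinity, and these can be
    evaluated, unlike elements of an abstract [realType]. *)
Definition ereal_of_onat (x : option nat) : \bar R :=
  if x is Some k then k%:R%:E else +oo%E.
Local Notation e := ereal_of_onat.

(* [None] stands for infinity. *)
Definition onat_add (x y : option nat) :=
  if x is Some k then if y is Some l then Some (k + l)%N else None else None.
Definition onat_lt (x y : option nat) :=
  if x is Some k then if y is Some l then (k < l)%N else true else false.
Definition onat_min x y := if onat_lt x y then x else y.
Definition onat_twice x y z :=
  let m := onat_min x (onat_min y z) in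
  (m == None) || (1 < count_mem m [:: x; y; z])%N.

Lemma ereal_of_onatD x y : e (onat_add x y) = (e x + e y)%E.
Proof. by case: x y => [k|] [l|] //=; rewrite natrD EFinD. Qed.

Lemma ereal_of_onat_min x y : e (onat_min x y) = Order.min (e x) (e y).
Proof.
suff lt_e : (e x < e y)%E = onat_lt x y.
  by rewrite /onat_min /Order.min lt_e; case: ifP.
by case: x y => [k|] [l|] //=; rewrite ?ltry ?ltxx ?lte_fin ?ltr_nat.
Qed.

Lemma ereal_of_onat_inj : injective e.
Proof.
by case=> [k|] [l|] //= [] /eqP; rewrite eqr_nat => /eqP ->.
Qed.

Lemma min_attained_twice_onat x y z :
  onat_twice x y z -> min_attained_twice (e x) (e y) (e z).
Proof.
rewrite /onat_twice /min_attained_twice -!ereal_of_onat_min.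
move=> /orP[/eqP -> | two]; [by left | right].
by move: two; rewrite /= !(inj_eq ereal_of_onat_inj).
Qed.

End OptionEreal.

Section BitDressian.
Variables (R : realType) (n d : nat) (M N : matroid [set: 'I_n] d).
Variables r q : pred bitseq.

Definition bits_value s : option nat :=
  if r s then Some (~~ q s : nat) else None.

(** The [if] keeps call-by-value evaluation from computing the sums for repeated indices, as [==>]
    would. *)
Definition is_dressian_bits :=
  all (fun s =>
    let J := [seq i <- iota 0 n | ~~ nth false s i] in
    let w i j := bits_value (set_nth false (set_nth false s j true) i true) in
    all (fun i => all (fun j => all (fun k => all (fun l =>
      if uniq [:: i; j; k; l] then
        onat_twice (onat_add (w i j) (w k l)) (onat_add (w i k) (w j l))
          (onat_add (w i l) (w j k))
      else true) J) J) J) J)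
    [seq s <- bitseqs n | (count id s + 2)%N == d].

Hypotheses (defM : bases M = [set A | r (bits A)]).
Hypotheses (defN : bases N = [set A | q (bits A)]).

Lemma extend_sub_valuation A :
  extend (sub_valuation R M N) A = ereal_of_onat R (bits_value (bits A)).
Proof.
have memM : (A \in bases M) = r (bits A) by rewrite defM inE.
rewrite /extend /bits_value -memM; case: insubP => [b -> bA|/negPf -> //].
by rewrite ffunE bA defN inE.
Qed.

Lemma dressian_sub_valuation :
  is_dressian_bits -> dressian (sub_valuation R M N).
Proof.
move=> /allP chk S _ cS i j k l uniq_ijkl sub_ijkl /=.
rewrite !extend_sub_valuation !bits_setU1 -!ereal_of_onatD.
apply: min_attained_twice_onat.
pose J (x : 'I_n) := val x \in [seq i <- iota 0 n | ~~ nth false (bits S) i].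
have inJ x : x \in [:: i; j; k; l] -> J x.
  move=> /sub_ijkl; rewrite inE in_setT andbT => xS.
  by rewrite /J mem_filter nth_bits xS mem_iota ltn_ord.
have /chk : bits S \in [seq s <- bitseqs n | (count id s + 2)%N == d].
  by rewrite mem_filter mem_bitseqs size_bits count_bits cS !eqxx.
have [Ji Jj Jk Jl] : [/\ J i, J j, J k & J l].
  by split; apply: inJ; rewrite !inE eqxx ?orbT.
move=> /allP/(_ _ Ji)/allP/(_ _ Jj)/allP/(_ _ Jk)/allP/(_ _ Jl).
have -> // : uniq [:: val i; val j; val k; val l].
by rewrite (map_inj_uniq val_inj [:: i; j; k; l]).
Qed.

End BitDressian.

(** * Linear relations forced by parallel elements *)

Section BasisValue.
Variables (R : realType) (T : finType) (E : {set T}) (d : nat).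
Variables (M : matroid E d) (v : {ffun basis M -> R}).

(** [fine] sends infinity to 0, so the value is meaningful on bases only. *)
Definition basis_value (A : {set T}) : R := fine (extend v A).
Local Notation g := basis_value.

Lemma extend_basis A : A \in bases M -> extend v A = (g A)%:E.
Proof. by rewrite /g /extend => AM; rewrite insubT. Qed.

Lemma extend_nonbasis A : A \notin bases M -> extend v A = +oo%E.
Proof. by rewrite /extend => AM; rewrite insubF // (negPf AM). Qed.

Lemma basis_value_val (b : basis M) : g (val b) = v b.
Proof. by rewrite /g /extend valK. Qed.

Lemma basis_value_initial A B :
  A \in initial_bases v -> B \in bases M -> g A <= g B.
Proof.
move=> /imsetP[b + ->] BM; rewrite inE => /forallP bmin.
by have := bmin (exist _ B BM); rewrite -!basis_value_val.
Qed.

Lemma basis_value_noninitial A B : A \in initial_bases v -> B \in bases M ->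
  B \notin initial_bases v -> g A < g B.
Proof.
move=> Av BM; apply: contraNT; rewrite -leNgt => BA.
apply/imsetP; exists (exist _ B BM) => //; rewrite inE; apply/forallP => c.
rewrite -!basis_value_val; apply: le_trans BA _.
exact: basis_value_initial Av (valP c).
Qed.

(* If [i] and [j] are parallel in the contraction of [S], the first of the three
   terms is infinite, so that the other two agree. *)
Lemma dressian_parallel (S : {set T}) (i j k l : T) : dressian v ->
  S \subset E -> (#|S| + 2)%N = d -> uniq [:: i; j; k; l] ->
  {subset [:: i; j; k; l] <= E :\: S} ->
  let B a b := a |: (b |: S) in
  B i j \notin bases M -> B i k \in bases M -> B j l \in bases M ->
  B i l \in bases M -> B j k \in bases M ->
  g (B i k) + g (B j l) = g (B i l) + g (B j k).
Proof.
move=> Dv SE cS uS subS B ij ik jl il jk.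
have := Dv S SE cS i j k l uS subS; rewrite /= -!/(B _ _).
rewrite (extend_nonbasis ij) (extend_basis ik) (extend_basis jl).
rewrite (extend_basis il) (extend_basis jk) -!EFinD.
have -> : (+oo + extend v (B k l) = +oo)%E.
  by rewrite /extend; case: insub.
rewrite /min_attained_twice min_r ?leey //.
(* The minimum of the two remaining terms is finite, hence attained twice; a strict inequality
   between them would leave it attained once. *)
case; first by case: leP => _ [].
have [lt_ab|lt_ba|[] //] := ltgtP; rewrite /= eqxx.
  by rewrite (gt_eqF lt_ab) addn0.
by rewrite (gt_eqF lt_ba).
Qed.

End BasisValue.

(** * Bases named by lists of numbers *)

Section NatSets.
Variable n : nat.

Definition nat_set (s : seq nat) : {set 'I_n} := [set x | val x \in s].

Lemma bits_nat_set s : bits (nat_set s) = [seq m \in s | m <- iota 0 n].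
Proof.
by rewrite -val_enum_ord -map_comp; apply: eq_map => x; rewrite inE.
Qed.

Lemma nat_set_cons x s (ltx : (x < n)%N) :
  nat_set (x :: s) = Ordinal ltx |: nat_set s.
Proof. by apply/setP => y; rewrite !inE. Qed.

Lemma nat_set_sort s : nat_set (sort leq s) = nat_set s.
Proof. by apply/setP => y; rewrite !inE mem_sort. Qed.

Variables (R : realType) (d : nat) (M : matroid [set: 'I_n] d).
Variable r : pred bitseq.
Hypothesis defM : bases M = [set A | r (bits A)].
Variable v : {ffun basis M -> R}.

(** Sorting makes all concrete listings of a set convertible, so that each basis is a single unknown
    of the final linear system. *)
Definition nat_value s := basis_value v (nat_set (sort leq s)).

Lemma nat_set_bases s :
  (nat_set s \in bases M) = r [seq m \in s | m <- iota 0 n].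
Proof. by rewrite defM inE bits_nat_set. Qed.

(** All side conditions form one boolean, which evaluates to [true] on concrete numbers. *)
Lemma dressian_parallel_nat : dressian v -> forall s i j k l,
  let b a b := r [seq m \in a :: b :: s | m <- iota 0 n] in
  [&& all (ltn^~ n) [:: i, j, k, l & s], uniq [:: i, j, k, l & s],
      (size s + 2)%N == d,
      ~~ b i j, b i k, b j l, b i l & b j k] ->
  nat_value [:: i, k & s] + nat_value [:: j, l & s] =
  nat_value [:: i, l & s] + nat_value [:: j, k & s].
Proof.
move=> Dv s i j k l b /and5P[/and5P[li lj lk ll /allP ls] us /eqP sd].
rewrite /b -!nat_set_bases !(nat_set_cons _ li, nat_set_cons _ lj,
  nat_set_cons _ lk, nat_set_cons _ ll) => ij /and4P[ik jl il jk].
rewrite /nat_value !nat_set_sort !(nat_set_cons _ li, nat_set_cons _ lj,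
  nat_set_cons _ lk, nat_set_cons _ ll).
have := us; rewrite -[_ :: _]/([:: i; j; k; l] ++ s) cat_uniq.
move=> /and3P[u4 dis u_s].
apply: dressian_parallel => //.
- rewrite -sd -count_bits bits_nat_set count_map; congr (_ + _)%N.
  rewrite -size_filter; apply/perm_size/uniq_perm.
  + exact: filter_uniq (iota_uniq _ _).
  + exact: u_s.
  + by move=> x; rewrite mem_filter mem_iota; apply: andb_idr => /ls.
- move=> x; rewrite !inE andbT => xin; apply: contra dis => xs.
  by apply/hasP; exists (val x); rewrite // !inE; move: xin; rewrite !orbA.
Qed.

End NatSets.

Local Close Scope ring_scope.

(** * The three matroids and their verification *)

(** Positions 6 and 7 occur in none of the four lines: these are the free points z and w. *)
Definition k4_bits (s : bitseq) : bool :=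
  (count id s == 3) &&
  ~~ has (all (nth false s)) 
    [:: [:: 0; 1; 3]; [:: 1; 2; 4]; [:: 0; 2; 5]; [:: 3; 4; 5]].

Definition line_bits (s : bitseq) : bool :=
  k4_bits s && (nth false s 6 || nth false s 7).

Definition parallel_bits (s : bitseq) : bool :=
  line_bits s && ~~ (nth false s 0 && nth false s 3).

Lemma matroid_k4 : is_matroid_bits 8 3 k4_bits.
Proof. by vm_compute. Qed.
Lemma matroid_line : is_matroid_bits 8 3 line_bits.
Proof. by vm_compute. Qed.
Lemma matroid_parallel : is_matroid_bits 8 3 parallel_bits.
Proof. by vm_compute. Qed.
Lemma dressian_k4_line : is_dressian_bits 8 3 k4_bits line_bits.
Proof. by vm_compute. Qed.
Lemma dressian_line_parallel : is_dressian_bits 8 3 line_bits parallel_bits.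
Proof. by vm_compute. Qed.

Lemma parallel_exchangeable : all (fun x => all (fun y =>
  (x != y) ==> has (fun i => has (fun j =>
   let b a := parallel_bits [seq m \in [:: a; i; j] | m <- iota 0 8] in
   [&& x != i, x != j, y != i, y != j, b x & b y])
    (iota 0 8)) (iota 0 8)) (iota 0 8)) (iota 0 8).
Proof. by vm_compute. Qed.

Theorem theorem5p2 (R : realType) :
  exists (n d : nat) (M M' M'' : matroid [set: 'I_n] d),
    [/\ connected M, connected M' & connected M''] /\
    [/\ initial_matroid R M M', initial_matroid R M' M''
      & ~ initial_matroid R M M''].
Proof.
have [M defM] := matroid_of_bits matroid_k4.
have [M' defM'] := matroid_of_bits matroid_line.
have [M'' defM''] := matroid_of_bits matroid_parallel.
have M'M : bases M' \subset bases M.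
  by rewrite defM defM'; apply/subsetP => A; rewrite !inE => /andP[].
have M''M' : bases M'' \subset bases M'.
  by rewrite defM'' defM'; apply/subsetP => A; rewrite !inE => /andP[].
(* The exchange criterion survives adding bases, so checking it on [M''] settles all three
   matroids. *)
have conn (N : matroid [set: 'I_8] 3) : bases M'' \subset bases N -> connected N.
  move=> /subsetP sub; apply: exchangeable_connected => x y _ _ xy.
  have /allP/(_ (val x)) := parallel_exchangeable.
  rewrite mem_iota ltn_ord => /(_ isT)/allP/(_ (val y)).
  rewrite mem_iota ltn_ord (inj_eq val_inj) xy => /(_ isT).
  case/hasP=> i _ /hasP[j _ /and5P[xi xj yi yj /andP[bx by_]]].
  exists (nat_set 8 [:: i; j]); rewrite !inE !negb_or xi xj yi yj.
  have E (z : 'I_8) : z |: nat_set 8 [:: i; j] = nat_set 8 [:: val z; i; j].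
    by apply/setP => t; rewrite !inE.
  by split=> //; apply: sub; rewrite E (nat_set_bases defM'').
exists 8, 3, M, M', M''; split.
  by split; apply: conn => //; apply: subset_trans M'M.
split.
- exists (sub_valuation R M M'); last exact: initial_sub_valuation.
  exact: dressian_sub_valuation defM defM' dressian_k4_line.
- exists (sub_valuation R M' M''); last exact: initial_sub_valuation.
  exact: dressian_sub_valuation defM' defM'' dressian_line_parallel.
case=> v Dv defv.
have eqv := dressian_parallel_nat defM Dv.
pose V := nat_value v.
(* Contracting d, e, f in turn makes ab, bc, ca parallel. The sum of [r1], [r2], [r3] is the
   quadrangular relation up to six terms free of z. *)
have r1 : (V [:: 0; 3; 6] + V [:: 1; 2; 3] = V [:: 0; 2; 3] + V [:: 1; 3; 6])%R.
  exact: (eqv [:: 3] 0 1 6 2).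
have r2 : (V [:: 1; 4; 6] + V [:: 0; 2; 4] = V [:: 0; 1; 4] + V [:: 2; 4; 6])%R.
  exact: (eqv [:: 4] 1 2 6 0).
have r3 : (V [:: 2; 5; 6] + V [:: 0; 1; 5] = V [:: 1; 2; 5] + V [:: 0; 5; 6])%R.
  exact: (eqv [:: 5] 2 0 6 1).
(* These relations live on K, one for each of its four lines; [r5 - r4 + r6 - r7] cancels the six
   terms. *)
have r4 : (V [:: 0; 1; 2] + V [:: 2; 3; 4] = V [:: 1; 2; 3] + V [:: 0; 2; 4])%R.
  exact: (eqv [:: 2] 1 4 0 3).
have r5 : (V [:: 0; 1; 2] + V [:: 2; 3; 5] = V [:: 0; 2; 3] + V [:: 1; 2; 5])%R.
  exact: (eqv [:: 2] 0 5 1 3).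
have r6 : (V [:: 0; 1; 4] + V [:: 0; 3; 5] = V [:: 0; 1; 5] + V [:: 0; 3; 4])%R.
  exact: (eqv [:: 0] 1 3 4 5).
have r7 : (V [:: 0; 3; 4] + V [:: 2; 3; 5] = V [:: 2; 3; 4] + V [:: 0; 3; 5])%R.
  exact: (eqv [:: 3] 4 5 0 2).
have V_le (s t : seq nat) :
    parallel_bits [seq m \in sort leq s | m <- iota 0 8] ->
    k4_bits [seq m \in sort leq t | m <- iota 0 8] -> (V s <= V t)%R.
  rewrite -(nat_set_bases defM'') -(nat_set_bases defM) defv.
  exact: basis_value_initial.
(* Here adz is a basis of [M] but not of [M''], whence strictness. With the two weak inequalities
   below, one side of the quadrangular relation is strictly smaller than the other. *)
have lt_ad : (V [:: 1; 3; 6] < V [:: 0; 3; 6])%R.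
  apply: basis_value_noninitial; rewrite -?defv.
  - by rewrite (nat_set_bases defM'').
  - by rewrite (nat_set_bases defM).
  - by rewrite (nat_set_bases defM'').
have le_ce : (V [:: 2; 4; 6] <= V [:: 1; 4; 6])%R by apply: V_le.
have le_af : (V [:: 0; 5; 6] <= V [:: 2; 5; 6])%R by apply: V_le.
move: r1 r2 r3 r4 r5 r6 r7 lt_ad le_ce le_af; clear; lra.
Qed.
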